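(* Let $P$ be a shoelace poset on $n\ge 2$ elements and let $z\in P$. Then $|\mathcal{T}_z(P)|\le (n-2)!$. Equality holds if and only if there is a unique minimal element $x$ of $P$ such that $x<_P z$.
   Context: All posets are finite. Let $P$ be a poset with $n$ elements. A labeling of $P$ is a bijection $L:P\to\{1,\dots,n\}$; it is natural if $x<_P y$ implies $L(x)<L(y)$. The (extended) promotion $\partial L$ of a labeling $L$ is obtained as follows: (1) repeat until the element labeled $1$ is maximal: let $u$ be the element labeled $1$ and let $v$ be the element with the smallest label among all elements $v>_P u$; swap the labels of $u$ and $v$; (2) then simultaneously replace the label $1$ by $n$ and each label $i>1$ by $i-1$. The order of $L$ is the smallest $k\ge 0$ such that $\partial^k L$ is natural (it is known that the order is always at most $n-1$). $L$ is tangled if its order equals $n-1$. For $z\in P$, $\mathcal{T}_z(P)$ denotes the set of tangled labelings $L$ of $P$ with $L(z)=n-1$. A shoelace poset is a connected poset $P$ (i.e. its Hasse diagram is a connected graph) with set of minimal elements $\{x_1,\dots,x_\ell\}$, set of maximal elements $\{y_1,\dots,y_m\}$, and a set $\mathcal{S}(P)\subseteq\{x_1,\dots,x_\ell\}\times\{y_1,\dots,y_m\}$ such that: (1) for every $(i,j)\in[\ell]\times[m]$, $x_i$ and $y_j$ are comparable in $P$ if and only if $(x_i,y_j)\in\mathcal{S}(P)$; (2) for every $(x_i,y_j)\in\mathcal{S}(P)$ the open interval $(x_i,y_j)_P$ is a (possibly empty) chain, denoted $C_i^j$; (3) for distinct pairs $(x_i,y_j),(x_{i'},y_{j'})\in\mathcal{S}(P)$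 the chains $C_i^j$ and $C_{i'}^{j'}$ are disjoint. *)

(* Defs.v *)
From mathcomp Require Import all_boot all_order.
Set Implicit Arguments.
Unset Strict Implicit.
Unset Printing Implicit Defensive.

Section Posets.
Variables (d : Order.disp_t) (T : finPOrderType d).
Implicit Types (x y z c u v w : T) (L : T -> nat).

Definition minimal x := [forall y, ~~ (y < x)%O].

Definition maximal x := [forall y, ~~ (x < y)%O].

Definition covers x y := (x < y)%O && [forall z, ~~ ((x < z)%O && (z < y)%O)].

Definition hasse_connected :=
  forall x y, connect (fun a b => covers a b || covers b a) x y.

Definition open_interval x y : {set T} := [set c | (x < c)%O && (c < y)%O].

Definition is_chain (A : {set T}) := {in A &, forall a b, (a >=< b)%O}.

Definition shoelace_pairs (S : {set T * T}) : Prop :=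
  [/\ {in S, forall p, minimal p.1 && maximal p.2},
      forall x y, minimal x -> maximal y -> (x >=< y)%O = ((x, y) \in S),
      {in S, forall p, is_chain (open_interval p.1 p.2)}
    & {in S &, forall p q, p != q ->
        [disjoint open_interval p.1 p.2 & open_interval q.1 q.2]}].

Definition shoelace : Prop :=
  hasse_connected /\ exists S : {set T * T}, shoelace_pairs S.

(* Each of the labels 1, ..., #|T| is used exactly once. *)
Definition labeling L := perm_eq (codom L) (iota 1 #|T|).

Definition natural L := [forall x, forall y, (x < y)%O ==> (L x < L y)].

(* One exchange of step (1); nothing happens once the element labeled 1 is
   maximal. *)
Definition exchange L : T -> nat :=
  if [pick u | L u == 1] is Some u then
    if [pick v | (u < v)%O && [forall w, (u < w)%O ==> (L v <= L w)]] is Some v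
    then fun x => if x == u then L v else if x == v then L u else L x
    else L
  else L.

(* Every effective exchange moves the label 1 strictly up in the poset, so
   #|T| exchanges bring it to a maximal element. *)
Definition promotion L : T -> nat :=
  let L' := iter #|T| exchange L in
  fun x => if L' x == 1 then #|T| else (L' x).-1.

Definition has_order L k : Prop :=
  natural (iter k promotion L) /\
  forall j, j < k -> ~~ natural (iter j promotion L).

Definition tangled L : bool :=
  natural (iter #|T|.-1 promotion L) &&
  [forall j : 'I_(#|T|.-1), ~~ natural (iter j promotion L)].

Lemma tangledP L : reflect (has_order L #|T|.-1) (tangled L).
Proof.
apply: (iffP andP) => -[nat_n nat_lt]; split=> //.
  by move=> j lt_j; apply: (forallP nat_lt (Ordinal lt_j)).
by apply/forallP => j; apply: nat_lt.
Qed.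

(* Labels are at most #|T|, so labelings form a finite set of functions into
   'I_#|T|.+1 = {0, ..., #|T|}. *)
Definition tangled_at z : {set {ffun T -> 'I_#|T|.+1}} :=
  [set f : {ffun T -> 'I_#|T|.+1} |
     let L := fun x => f x : nat in
     [&& labeling L, tangled L & L z == #|T|.-1]].

End Posets.

(* Main.v *)
Require Import Defs.
From mathcomp Require Import all_boot all_order.
From mathcomp Require Import fingroup perm zify.

(** Write n for the number of elements and L_k for the k-th promotion of a
labeling L.

One promotion moves the label 1 up a path Q: from an element of Q the path
goes to the element above it with the smallest label, that label drops to the
element just left, and the path ends at a maximal element ([slide],
[promotion_slide]).  Following a label through all promotions, where it loses
1 each time, one sees a token that only ever moves down in the poset.

After k promotions an element with a label above n - k is in order with all
elements above it ([iter_frozen]), so L_(n-1) is natural, and L is tangled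
exactly when L_(n-2) is not natural ([tangledE]): in L_(n-2) the label 2 then lies
below the label 1, while all other labels are in order.  The tokens that carry
the labels 2 and 1 at that time are those that started with n and n-1.  The
token n of a tangled labeling never moves, because a move would put it into
order with everything above it; so it sits on a minimal element x throughout,
and the token n-1, which starts at z, ends at an element y > x below which
there is nothing but x ([tangled_top_fixed], [tangled_end_below]).  In
particular x < z.

If x is the only minimal element below z, the converse holds as well: wherever
the token n-1 ends, it is above x.  The tangled labelings with L z = n-1 are
then all the labelings with L x = n and L z = n-1, and there are (n-2)! of
them ([card_tangled_unique]).  If there is no minimal element below z, there
is no tangled labeling with L z = n-1.

Suppose that several minimal elements lie below z.  What matters about a
shoelace poset is that an element that is neither minimal nor maximal has one
minimal element below it and one maximal element above it
([shoelace_pinched]).  So z is maximal, and the non-minimal elements below z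
form a set U that a path can only leave through z.  Consider the first path
that goes through z, and hence moves the token n-1.  Since the token must end
above x, this path has to start inside U at an element above x; as the labels
on U have only been decremented before, that element carries the smallest
label of L on U ([first_passage]).  Therefore the position of n in L can be
recovered from L restricted to U, as the minimal element below the place of
this smallest label.  Fix one x that occurs in this way and exchange, in each
tangled L, the label at x with the label n: this map into the (n-2)! labelings
with L x = n and L z = n-1 does not change labels on U, so it is injective.
It is not onto: if U carries the largest labels other than n-1 and n, and the smallest
of them is above x, then the argument just given would force everything
outside U, x and z, including another minimal element below z, to be frozen
while z is not; such a labeling is not tangled ([late_middle_untangled]).
Hence the inequality is strict ([card_tangled_lt]). *)

Section Promotion.
Set Implicit Arguments.
Unset Strict Implicit.
Unset Printing Implicit Defensive.
Import Order.TTheory.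

Variables (d : Order.disp_t) (T : finPOrderType d).
Implicit Types (L M : T -> nat) (Q : {set T}) (u v w x y z c e : T).

(** * Labelings and extremal elements *)

Lemma labelingP L :
  labeling L <-> injective L /\ forall x, 0 < L x <= #|T|.
Proof.
split=> [labL | [injL bndL]].
  split=> [|x]; first by apply/injectiveP; rewrite /injectiveb /dinjectiveb
    -/(codom L) (perm_uniq labL) iota_uniq.
  have := codom_f L x; rewrite (perm_mem labL) mem_iota; lia.
have uL : uniq (codom L) by apply/injectiveP.
have sL : {subset codom L <= iota 1 #|T|}.
  by move=> _ /codomP[x ->]; rewrite mem_iota; have := bndL x; lia.
have [] := uniq_min_size uL sL; first by rewrite size_iota size_codom.
by move=> _ eqL; apply: uniq_perm; rewrite ?iota_uniq.
Qed.

Lemma labeling_onto L i : labeling L -> 0 < i <= #|T| -> exists x, L x = i.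
Proof.
move=> labL bnd_i; have : i \in codom L.
  by rewrite (perm_mem labL) mem_iota; lia.
by case/codomP=> x ->; exists x.
Qed.

Lemma nonmaximal x : ~~ maximal x -> exists y, (x < y)%O.
Proof. by case/forallPn=> y; rewrite negbK; exists y. Qed.

Lemma maximalN x y : maximal x -> (x < y)%O = false.
Proof. by move/forallP/(_ y)/negbTE. Qed.

Lemma minimalN x y : minimal x -> (y < x)%O = false.
Proof. by move/forallP/(_ y)/negbTE. Qed.

Lemma maximal_le x y : maximal x -> (x <= y)%O -> x = y.
Proof. by move=> mx; rewrite le_eqVlt maximalN // orbF => /eqP. Qed.

Lemma minimal_le x y : minimal x -> (y <= x)%O -> y = x.
Proof. by move=> mx; rewrite le_eqVlt minimalN // orbF => /eqP. Qed.

Lemma minimal_below x : exists2 a, minimal a & (a <= x)%O.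
Proof.
have [a lax min_a] :=
  arg_minnP (P := fun a => (a <= x)%O) (fun a => #|[set b | (b <= a)%O]|) (lexx x).
exists a => //; apply/forallP => b; apply/negP => lt_ba.
have := min_a b (le_trans (ltW lt_ba) lax); apply/negP; rewrite -ltnNge.
apply/proper_card/properP; split.
  by apply/subsetP=> c; rewrite !inE => /le_trans-> //; apply: ltW.
by exists a; rewrite !inE // lt_geF.
Qed.

Lemma maximal_above x : exists2 b, maximal b & (x <= b)%O.
Proof.
have [b lxb min_b] :=
  arg_minnP (P := fun b => (x <= b)%O) (fun b => #|[set c | (b <= c)%O]|) (lexx x).
exists b => //; apply/forallP => c; apply/negP => lt_bc.
have := min_b c (le_trans lxb (ltW lt_bc)); apply/negP; rewrite -ltnNge.
apply/proper_card/properP; split.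
  by apply/subsetP=> e; rewrite !inE; apply: le_trans; apply: ltW.
by exists b; rewrite !inE // lt_geF.
Qed.

(** * The path of one promotion *)

(** [Q] is the set of elements visited by the label 1 when [L] is promoted to
[L']; it is a chain from the element labeled 1 to a maximal element.  The
fields [slide_next] and [slide_prev] describe the same exchange seen from its
lower and from its upper end. *)
Record slide L L' Q : Prop := Slide {
  slide_start : forall u, L u = 1 -> u \in Q;
  slide_ge : forall u x, L u = 1 -> x \in Q -> (u <= x)%O;
  slide_out : forall x, x \notin Q -> L' x = (L x).-1;
  slide_max : forall x, x \in Q -> maximal x -> L' x = #|T|;
  slide_next : forall x, x \in Q -> ~~ maximal x ->
    exists v, [/\ v \in Q, (x < v)%O,
                  forall w, (x < w)%O -> L v <= L w & L' x = (L v).-1];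
  slide_prev : forall x, x \in Q -> L x != 1 ->
    exists u, [/\ u \in Q, (u < x)%O & L' u = (L x).-1];
  slide_end : exists q, [/\ q \in Q, maximal q & forall x, x \in Q -> (x <= q)%O]
}.

(** The state after [k] exchanges: the label 1 has moved from [u0] to [u]
along [Q], and the labels strictly above [u] are still those of [L], which is
why the path can be described by [L] alone.  By [psl_len] the path grows until
it reaches a maximal element, so that #|T| exchanges suffice. *)
Record partial_slide L M u0 u Q k : Prop := PartialSlide {
  psl_lab : labeling M;
  psl_cur : u \in Q;
  psl_cur1 : M u = 1;
  psl_start : u0 \in Q;
  psl_ge : forall x, x \in Q -> (u0 <= x <= u)%O;
  psl_out : forall x, x \notin Q -> M x = L x;
  psl_next : forall x, x \in Q -> x != u ->
    exists v, [/\ v \in Q, (x < v)%O,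
                  forall w, (x < w)%O -> L v <= L w & M x = L v];
  psl_prev : forall x, x \in Q -> x != u0 ->
    exists p, [/\ p \in Q, (p < x)%O & M p = L x];
  psl_len : maximal u \/ k < #|Q|
}.

Lemma exchange_max M u : labeling M -> M u = 1 -> maximal u -> exchange M = M.
Proof.
move=> /labelingP[injM _] Mu max_u; rewrite /exchange.
case: pickP => [u' /eqP Mu'|//].
have {Mu'}->: u' = u by apply: injM; rewrite Mu'.
by case: pickP => [v /andP[]|//]; rewrite maximalN.
Qed.

Lemma exchange_swap M u : labeling M -> M u = 1 -> ~~ maximal u ->
  exists v, [/\ (u < v)%O, forall w, (u < w)%O -> M v <= M w &
    exchange M = fun x => if x == u then M v else if x == v then M u else M x].
Proof.
move=> /labelingP[injM _] Mu /nonmaximal[y lt_uy]; rewrite /exchange.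
case: pickP => [u' /eqP Mu'|/(_ u)]; last by rewrite Mu.
have {u' Mu'}->: u' = u by apply: injM; rewrite Mu'.
case: pickP => [v /andP[lt_uv /forallP min_v]|none].
  by exists v; split=> // w lt_uw; apply: (implyP (min_v w)).
have [v lt_uv min_v] := arg_minnP (P := fun v => (u < v)%O) M lt_uy.
by have := none v; rewrite lt_uv => /forallP[]w; apply/implyP/min_v.
Qed.

Lemma swap_labeling M u v : labeling M ->
  labeling (fun x => if x == u then M v else if x == v then M u else M x).
Proof.
move=> /labelingP[injM bndM]; apply/labelingP.
have E x : (if x == u then M v else if x == v then M u else M x) = M (tperm u v x).
  by case: tpermP => [->|->|/eqP/negbTE-> /eqP/negbTE->] //;
    rewrite eqxx //; case: eqP => // ->.
by split=> [x y|x]; rewrite !E // => /injM/perm_inj.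
Qed.

Lemma partial_slideP L u0 k : labeling L -> L u0 = 1 ->
  exists u Q, partial_slide L (iter k (@exchange d T) L) u0 u Q k.
Proof.
move=> labL Lu0; elim: k => [|k [u [Q S]]].
  exists u0, [set u0]; split; rewrite ?inE //=.
  - by move=> x /set1P->; rewrite lexx.
  - by move=> x /set1P->; rewrite eqxx.
  - by move=> x /set1P->; rewrite eqxx.
  - by right; rewrite cards1.
set M := iter k (@exchange d T) L in S; rewrite iterS -/M.
have [max_u | max'u] := boolP (maximal u).
  exists u, Q; rewrite (exchange_max (psl_lab S) (psl_cur1 S) max_u).
  by case: S => *; split=> //; left.
have [v [lt_uv min_v ->]] := exchange_swap (psl_lab S) (psl_cur1 S) max'u.
have vQ : v \notin Q by apply: contraL lt_uv => /(psl_ge S)/andP[_ /le_gtF->].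
have Mout w : (u < w)%O -> M w = L w.
  move=> lt_uw; apply: (psl_out S); apply: contraL lt_uw.
  by move/(psl_ge S)/andP=> [_ /le_gtF->].
have vu : (v == u) = false by rewrite gt_eqF.
have [_ uQ Mu u0Q geQ outQ nextQ prevQ lenQ] := S.
exists v, (v |: Q); split.
- exact: swap_labeling (psl_lab S).
- by rewrite !inE eqxx.
- by rewrite vu eqxx.
- by rewrite !inE u0Q orbT.
- move=> x; rewrite !inE => /predU1P[->|xQ]; last first.
    by have /andP[-> le_xu] := geQ x xQ; exact: ltW (le_lt_trans le_xu lt_uv).
  rewrite lexx andbT; have /andP[le_u0u _] := geQ u uQ.
  exact: le_trans le_u0u (ltW lt_uv).
- move=> x; rewrite !inE negb_or => /andP[/negbTE-> xQ].
  by rewrite (outQ x) // ifN //; apply: contraNneq xQ => ->.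
- move=> x; rewrite !inE => /predU1P[->|xQ _]; first by rewrite eqxx.
  have [->|xu] := eqVneq x u.
    exists v; rewrite !inE eqxx; split=> // [w lt_uw|].
      by rewrite -!Mout // min_v.
    by rewrite Mout.
  have [w [wQ lt_xw min_w Mx]] := nextQ x xQ xu.
  exists w; rewrite !inE wQ orbT; split=> //.
  by case: eqP => // xv; rewrite -xv xQ in vQ.
- move=> x; rewrite !inE => /predU1P[->|xQ xu0].
    by exists u; rewrite !inE uQ orbT eqxx Mout.
  have [p [pQ lt_px Mp]] := prevQ x xQ xu0.
  have pu : (p == u) = false.
    by apply: lt_eqF; have /andP[_] := geQ x xQ; apply: lt_le_trans.
  exists p; rewrite !inE pQ orbT pu; split=> //.
  by case: eqP => // pv; rewrite -pv pQ in vQ.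
- by right; rewrite cardsU1 vQ; case: lenQ max'u => [->|].
Qed.

Lemma promotion_slide L : 1 < #|T| -> labeling L ->
  labeling (promotion L) /\ exists Q, slide L (promotion L) Q.
Proof.
move=> T1 labL; have [|u0 Lu0] := labeling_onto (i := 1) labL; first lia.
have [u [Q]] := partial_slideP #|T| labL Lu0; rewrite /promotion.
set M := iter _ _ _ => -[labM uQ Mu u0Q geQ outQ nextQ prevQ lenQ].
have /labelingP[injL _] := labL; have /labelingP[injM bndM] := labM.
have M1 x : x != u -> (M x == 1) = false.
  by move=> xu; apply: contraNF xu; rewrite -Mu => /eqP/injM->.
split; first apply/labelingP.
  split=> [x y|x]; last by have := bndM x; case: eqP; lia.
  have := bndM x; have := bndM y.
  by case: eqP => Mx; case: eqP => My bx b_y E; apply: injM; lia.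
have max_u : maximal u by case: lenQ => //; rewrite ltnNge max_card.
exists Q; split.
- by move=> w; rewrite -Lu0 => /injL->.
- by move=> w x; rewrite -Lu0 => /injL-> /geQ/andP[].
- by move=> x xQ; rewrite M1 ?outQ //; apply: contraNneq xQ => ->.
- move=> x /geQ/andP[_ le_xu] max_x.
  by rewrite (maximal_le max_x le_xu) Mu.
- move=> x xQ max'x; have xu : x != u by apply: contraNneq max'x => ->.
  have [v [vQ lt_xv min_v Mx]] := nextQ x xQ xu.
  by exists v; rewrite M1 // Mx.
- move=> x xQ Lx; have [|p [pQ lt_px Mp]] := prevQ x xQ.
    by apply: contraNneq Lx => ->; rewrite Lu0.
  exists p; rewrite M1 ?Mp //.
  by rewrite lt_eqF //; have /andP[_] := geQ x xQ; apply: lt_le_trans.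
- by exists u; split=> // x /geQ/andP[].
Qed.

(** * Frozen labels *)

Section Dynamics.
Hypothesis T1 : 1 < #|T|.

Lemma iter_labeling L k : labeling L -> labeling (iter k (@promotion d T) L).
Proof. by move=> labL; elim: k => //= k /(promotion_slide T1)[]. Qed.

Lemma iter_slide L k : labeling L ->
  exists Q, slide (iter k (@promotion d T) L) (iter k.+1 (@promotion d T) L) Q.
Proof. by move=> labL; have [] := promotion_slide T1 (iter_labeling k labL). Qed.

Definition sorted_from m L := forall x y, (x < y)%O -> m <= L x -> L x < L y.

Lemma naturalP L : reflect (sorted_from 0 L) (natural L).
Proof.
apply: (iffP idP) => [/forallP natL x y lt_xy _ | sL].
  exact: implyP (forallP (natL x) y) lt_xy.
by apply/forallP=> x; apply/forallP=> y; apply/implyP=> lt_xy; apply: sL.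
Qed.

Lemma sorted_fromW m m' L : m <= m' -> sorted_from m L -> sorted_from m' L.
Proof. by move=> le_m sL x y lt_xy le_x; apply: sL => //; lia. Qed.

Lemma sorted_from2_natural L : labeling L -> sorted_from 2 L -> natural L.
Proof.
move=> /labelingP[injL bndL] sL; apply/naturalP=> x y lt_xy _.
have [|Lx] := leqP 2 (L x); first exact: sL.
have: L x <> L y by move=> /injL E; rewrite E ltxx in lt_xy.
by have := bndL x; have := bndL y; lia.
Qed.

(** The label that drops to a path element [x] was minimal above [x].  So it
lands in the right order with everything above [x] even if it was itself one
too small to be covered by the sortedness assumption: hence the bound [m.-1]
instead of the [m] of [slide_sorted].  The exceptional case is a [y] below the
place [v] where the label came from; there the label of [y] exceeds that of
[v], and sortedness at [y] is contradicted. *)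
Lemma slide_sorted_path m L L' Q x y : labeling L -> slide L L' Q ->
  sorted_from m.+1 L -> x \in Q -> (x < y)%O -> m.-1 <= L' x -> L' x < L' y.
Proof.
move=> /labelingP[injL bndL] S sL xQ lt_xy.
have max'x : ~~ maximal x by apply: contraL lt_xy => /maximalN->.
have [v [vQ lt_xv min_v ->]] := slide_next S xQ max'x => le_mv.
have bv := bndL v; have le_vy := min_v y lt_xy.
have [yQ|yQ] := boolP (y \in Q); last first.
  rewrite (slide_out S yQ); suff: L v <> L y by lia.
  by move=> /injL E; rewrite -E vQ in yQ.
have [/(slide_max S yQ)->|max'y] := boolP (maximal y); first lia.
have [w [wQ lt_yw min_w ->]] := slide_next S yQ max'y.
have le_vw := min_v w (lt_trans lt_xy lt_yw).
suff: L v <> L w by lia.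
move=> /injL E; rewrite -E in lt_yw.
have: L v <> L y by move=> /injL E'; rewrite E' ltxx in lt_yw.
by have := sL y v lt_yw; lia.
Qed.

Lemma slide_sorted m L L' Q : labeling L -> slide L L' Q ->
  sorted_from m L -> sorted_from m.-1 L'.
Proof.
move=> labL S /(sorted_fromW (leqSpred m)); move: m.-1 => {}m sL x y lt_xy le_mx.
have [xQ|xQ] := boolP (x \in Q).
  by apply: (slide_sorted_path labL S sL) => //; lia.
have /labelingP[_ bndL] := labL.
have := bndL x; have := sL x y lt_xy; move: le_mx.
rewrite (slide_out S xQ); have [yQ|yQ] := boolP (y \in Q); last first.
  by rewrite (slide_out S yQ); lia.
have [/(slide_max S yQ)->|max'y] := boolP (maximal y).
  by have := bndL y; lia.
have [w [wQ lt_yw _ ->]] := slide_next S yQ max'y.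
by have := sL y w lt_yw; lia.
Qed.

Local Notation "L ^^ k" := (iter k (@promotion d T) L) (at level 30).

Lemma iter_sorted L m i k : labeling L -> i <= k ->
  sorted_from m (L ^^ i) -> sorted_from (m - (k - i)) (L ^^ k).
Proof.
move=> labL + sL; elim: k => [|k IH].
  by rewrite leqn0 => /eqP <-; rewrite subnn subn0.
rewrite leq_eqVlt => /predU1P[<-|le_ik]; first by rewrite subnn subn0.
have [Q S] := iter_slide k labL; rewrite subSn // subnS.
exact: slide_sorted (iter_labeling k labL) S (IH le_ik).
Qed.

(** Each promotion freezes one more label, starting from the empty set of
labels above #|T|. *)
Lemma iter_frozen L k : labeling L -> sorted_from (#|T| - k).+1 (L ^^ k).
Proof.
move=> labL; have s0 : sorted_from #|T|.+1 (L ^^ 0).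
  by move=> x y _; have /labelingP[_ /(_ x)] := labL; rewrite /=; lia.
by apply: sorted_fromW (iter_sorted labL (leq0n k) s0); lia.
Qed.

Lemma iter_natural L i k : labeling L -> i <= k ->
  natural (L ^^ i) -> natural (L ^^ k).
Proof.
by move=> labL le_ik /naturalP /(iter_sorted labL le_ik) ?; apply/naturalP.
Qed.

(** After n - 1 promotions all labels from 2 on are frozen, which makes the
labeling natural; since naturality is never lost, tangled means not natural
one promotion earlier. *)
Lemma tangledE L : labeling L -> tangled L = ~~ natural (L ^^ (#|T| - 2)).
Proof.
move=> labL; apply/andP/idP => [[_ /forallP unnat]|unnat].
  have ltn : #|T| - 2 < #|T|.-1 by lia.
  exact: unnat (Ordinal ltn).
split; last first.
  apply/forallP=> j; apply: contra unnat; apply: iter_natural => //.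
  by have := ltn_ord j; lia.
apply: sorted_from2_natural; first exact: iter_labeling.
by have := iter_frozen (k := #|T|.-1) labL; congr sorted_from; lia.
Qed.

(** The label n - k is the largest label that is not frozen in L_k.  If it is
in order early, then it stays one step ahead of [iter_frozen], and L_(n-2) is
natural. *)
Lemma tangled_unsorted L k : labeling L -> tangled L -> k <= #|T| - 2 ->
  ~ sorted_from (#|T| - k) (L ^^ k).
Proof.
move=> labL; rewrite tangledE // => /negP unnat le_k sk; apply: unnat.
apply: sorted_from2_natural; first exact: iter_labeling.
by apply: sorted_fromW (iter_sorted labL le_k sk); lia.
Qed.

(** * The tokens n and n - 1 of a tangled labeling *)

(** If the token starting with label n moved, it would drop to a path element
and hence be in order with everything above by [slide_sorted_path], contrary to
[tangled_unsorted]. *)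
Lemma tangled_top_fixed L x k : labeling L -> tangled L -> L x = #|T| ->
  k <= #|T| - 2 -> (L ^^ k) x = #|T| - k.
Proof.
move=> labL tanL Lx; elim: k => [|k IH] lt_k; first by rewrite subn0.
have Lkx : (L ^^ k) x = #|T| - k by apply: IH; lia.
have [Q S] := iter_slide k labL.
have [xQ|xQ] := boolP (x \in Q); last by rewrite (slide_out S xQ) Lkx; lia.
have [|u [uQ _ L'u]] := slide_prev S xQ; first by rewrite Lkx; lia.
case: (tangled_unsorted labL tanL lt_k) => a b lt_ab le_a.
have /labelingP[inj' _] := iter_labeling k.+1 labL.
have [eq_a|ne_a] := eqVneq ((L ^^ k.+1) a) (#|T| - k.+1); last first.
  by apply: (iter_frozen labL) => //; lia.
have E : a = u by apply: inj'; rewrite L'u Lkx eq_a; lia.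
rewrite E in lt_ab *.
apply: (slide_sorted_path (iter_labeling k labL) S) lt_ab _ => //.
  exact: iter_frozen.
by rewrite L'u Lkx.
Qed.

(** In L_(n-2) all labels from 3 on are frozen, so an inversion can only be
the label 2 below the label 1, and a further element below either of them
would carry a label from 3 on, out of order. *)
Lemma tangled_end L x : labeling L -> tangled L -> L x = #|T| ->
  minimal x /\ exists y, [/\ (x < y)%O, (L ^^ (#|T| - 2)) y = 1 &
                            forall w, (w < y)%O -> w = x].
Proof.
move=> labL tanL Lx; have Nx := tangled_top_fixed labL tanL Lx (leqnn _).
have /labelingP[] := iter_labeling (#|T| - 2) labL.
have := iter_frozen (k := #|T| - 2) labL.
have := tanL; rewrite tangledE //; set N := L ^^ _ in Nx *.
have {Nx}Nx : N x = 2 by rewrite Nx; lia.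
have ->: (#|T| - (#|T| - 2)).+1 = 3 by lia.
case/forallPn=> a /forallPn[b]; rewrite negb_imply => /andP[lt_ab le_ba] s3 injN bndN.
have le_a2 : N a <= 2 by have := s3 a b lt_ab; lia.
have ne_ab : N a <> N b by move=> /injN E; rewrite E ltxx in lt_ab.
have [ba bb] := (bndN a, bndN b).
have ax : a = x by apply: injN; lia.
have Nb : N b = 1 by lia.
have low_b w : (w < b)%O -> w = x.
  move=> lt_wb; apply: (injN); have := s3 w b lt_wb; have := bndN w.
  by have : N w <> N b by [move=> /injN E; rewrite E ltxx in lt_wb]; lia.
split; last by exists b; rewrite -{1}ax.
apply/forallP=> w; apply/negP=> lt_wx.
have lt_wb : (w < b)%O by apply: lt_trans lt_wx _; rewrite -ax.
by rewrite (low_b w lt_wb) ltxx in lt_wx.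
Qed.

Lemma slide_token L L' Q x : slide L L' Q -> L x != 1 ->
  exists2 y, (y <= x)%O & L' y = (L x).-1.
Proof.
move=> S Lx; have [xQ|xQ] := boolP (x \in Q); last first.
  by exists x => //; apply: (slide_out S xQ).
by have [u [_ /ltW le_ux L'u]] := slide_prev S xQ Lx; exists u.
Qed.

Lemma iter_token L z k : labeling L -> k < L z ->
  exists2 y, (y <= z)%O & (L ^^ k) y = L z - k.
Proof.
move=> labL; elim: k => [|k IH] lt_k; first by exists z; rewrite ?subn0.
have [|y le_yz Ly] := IH; first lia.
have [Q S] := iter_slide k labL.
have [|y' le_y'y L'y'] := slide_token S (x := y); first by rewrite Ly; lia.
by exists y'; [apply: le_trans le_yz | rewrite L'y' Ly subnS].
Qed.

Lemma iter_minimal L x k : labeling L -> minimal x -> k < L x ->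
  (L ^^ k) x = L x - k.
Proof.
move=> labL min_x /(iter_token labL)[y le_yx <-].
by rewrite (minimal_le min_x le_yx).
Qed.

Lemma tangled_end_below L x z : labeling L -> tangled L ->
  L x = #|T| -> L z = #|T|.-1 ->
  exists y, [/\ (x < y)%O, (y <= z)%O, (L ^^ (#|T| - 2)) y = 1 &
               forall w, (w < y)%O -> w = x].
Proof.
move=> labL tanL Lx Lz; have [_ [y [lt_xy Ny low_y]]] := tangled_end labL tanL Lx.
have [|y' le_y'z Ny'] := iter_token (z := z) (k := #|T| - 2) labL; first lia.
have /labelingP[injN _] := iter_labeling (#|T| - 2) labL.
have E : y = y' by apply: injN; lia.
by exists y; rewrite {2}E.
Qed.

(** The token n stays at the minimal [x] and becomes the label 2; the token
n - 1 becomes the label 1 somewhere below [z], hence above [x]. *)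
Lemma tangled_unique_minimal L x z : labeling L ->
  L x = #|T| -> L z = #|T|.-1 -> minimal x -> (x < z)%O ->
  (forall a, minimal a -> (a < z)%O -> a = x) -> tangled L.
Proof.
move=> labL Lx Lz min_x lt_xz uniq_x; rewrite tangledE //.
have [|y le_yz Ny] := iter_token (z := z) (k := #|T| - 2) labL; first lia.
have Nx : (L ^^ (#|T| - 2)) x = 2 by rewrite iter_minimal // Lx; lia.
have [a min_a le_ay] := minimal_below y.
have ax : a = x.
  apply: uniq_x => //; rewrite lt_neqAle (le_trans le_ay) // andbT.
  by apply: contraTneq lt_xz => <-; rewrite minimalN.
have lt_xy : (x < y)%O.
  rewrite -ax lt_neqAle le_ay andbT; apply/eqP=> E.
  by move: Ny; rewrite -E ax Nx; lia.
by apply/negP=> /naturalP/(_ x y lt_xy); lia.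
Qed.

(** * The first promotion path through z *)

(** The combinatorial content of the shoelace condition that the counting
argument relies on; see [shoelace_pinched]. *)
Definition pinched := forall c, ~~ minimal c -> ~~ maximal c ->
  (forall a a', minimal a -> minimal a' -> (a < c)%O -> (a' < c)%O -> a = a') /\
  (forall b b', maximal b -> maximal b' -> (c < b)%O -> (c < b')%O -> b = b').

Definition middle z := [set c | (c < z)%O && ~~ minimal c].

(** Path [k] is the first one to meet [z]; a path through [middle z] meets [z]
as well, so up to that moment the labels on [z |: middle z] are those of [L]
minus [k].  The path shifts the token n - 1 from [z] to some [e < z].  As the
token ends strictly above [x], the element [e] is strictly above [x], and [x]
is the only minimal element below [e].  The start [u] of the path is at most
[e], and it is not [x], which carries a label greater than 1; so [u] is
strictly above [x] too.  The assumption on [a] ensures that such a path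
exists: [z] cannot be the end of the token, below which there is only [x]. *)
Lemma first_passage L x a z : pinched -> labeling L -> tangled L ->
  L x = #|T| -> L z = #|T|.-1 ->
  maximal z -> minimal a -> (a < z)%O -> a != x ->
  exists k u, [/\ k <= #|T| - 2, (x < u)%O, u \in middle z, L u = k.+1 &
    forall c, c \in z |: middle z -> (L ^^ k) c = L c - k /\ k < L c].
Proof.
move=> pin labL tanL Lx Lz max_z min_a lt_az ax.
have [min_x _] := tangled_end labL tanL Lx.
have [y [lt_xy _ Ny low_y]] := tangled_end_below labL tanL Lx Lz.
(* The first k paths have missed z |: middle z. *)
pose intact k := [forall (c | c \in z |: middle z),
  ((L ^^ k) c == L c - k) && (k < L c)].
have int0 : intact 0.
  apply/forall_inP=> c _; rewrite subn0 eqxx /=.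
  by have /labelingP[_ /(_ c)] := labL; lia.
have zz : z \in z |: middle z by rewrite !inE eqxx.
have not_end : ~~ intact (#|T| - 2).
  apply/negP=> /forall_inP/(_ z zz)/andP[/eqP Nz _].
  have /labelingP[injN _] := iter_labeling (#|T| - 2) labL.
  have E : y = z by apply: injN; rewrite Ny Nz Lz; clear -T1; lia.
  by move/eqP: ax; apply; apply: low_y; rewrite E.
have [k [lt_k int_k not_k]] :
    exists k, [/\ k < #|T| - 2, intact k & ~~ intact k.+1].
  elim: (#|T| - 2) not_end => [|m IH]; first by rewrite int0.
  have [int_m not_m|/IH[k [lt_k ik nk] _]] := boolP (intact m); first by exists m.
  by exists k; split; [exact: ltnW | exact: ik | exact: nk].
have {}int_k c : c \in z |: middle z -> (L ^^ k) c = L c - k /\ k < L c.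
  by move=> cz; have /andP[/eqP-> ->] := forall_inP int_k c cz.
have [Q S] := iter_slide k labL.
have [Lkz _] := int_k z zz.
(* A path that meets [middle z] ends at the only maximal element above: [z]. *)
have zQ : z \in Q.
  apply: contraNT not_k => zQ; apply/forall_inP => c cz.
  have cQ : c \notin Q.
    apply: contra zQ => cQ; have [q [qQ max_q /(_ c cQ) le_cq]] := slide_end S.
    move: cz; rewrite !inE => /predU1P[<- //|/andP[lt_cz min'c]].
    have max'c : ~~ maximal c by apply: contraL lt_cz => /maximalN->.
    have lt_cq : (c < q)%O.
      by rewrite lt_neqAle le_cq andbT; apply: contraNneq max'c => ->.
    have [_ /(_ q z max_q max_z lt_cq lt_cz) <-] := pin c min'c max'c.
    exact: qQ.
  have [Lkc lt_kc] := int_k c cz.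
  have Lc1 : (L ^^ k) c <> 1 by move/(slide_start S); apply/negP.
  rewrite (slide_out S cQ) Lkc; rewrite Lkc in Lc1.
  by clear -Lc1 lt_kc; lia.
clear int0 not_end not_k.
have [|e [eQ lt_ez Le]] := slide_prev S zQ; first by rewrite Lkz Lz; clear -lt_k; lia.
have [u Lku] : exists u, (L ^^ k) u = 1.
  by apply: labeling_onto; [exact: iter_labeling | exact: ltnW].
have le_ue := slide_ge S Lku eQ.
(* The token moved to [e] is the one that ends at [y]. *)
have le_ye : (y <= e)%O.
  have [||y' le_y'e] := @iter_token (L ^^ k.+1) e (#|T| - 2 - k.+1).
  - exact: iter_labeling.
  - by rewrite Le Lkz Lz; clear -lt_k; lia.
  rewrite -iterD subnK // Le Lkz => Ny'.
  have /labelingP[injN _] := iter_labeling (#|T| - 2) labL.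
  have -> // : y = y' by apply: injN; rewrite Ny Ny' Lz; clear -lt_k; lia.
have lt_xe : (x < e)%O by apply: lt_le_trans le_ye.
have min'e : ~~ minimal e by apply: contraL lt_xe => /minimalN->.
have max'e : ~~ maximal e by apply: contraL lt_ez => /maximalN->.
have ux : u != x.
  have Lkx := tangled_top_fixed labL tanL Lx (ltnW lt_k).
  by apply/eqP=> E; move: Lkx; rewrite -E Lku; clear -lt_k; lia.
have lt_xu : (x < u)%O.
  rewrite lt_neqAle eq_sym ux /=; have [b min_b le_bu] := minimal_below u.
  have [/(_ b x min_b min_x) <- //] := pin e min'e max'e.
  rewrite lt_neqAle (le_trans le_bu) // andbT.
  by apply: contraNneq min'e => <-.
have u_mid : u \in middle z.
  by rewrite inE (le_lt_trans le_ue lt_ez); apply: contraL lt_xu => /minimalN->.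
exists k, u; split=> //; first exact: ltnW.
have [|Lku' lt_ku] := int_k u; first by rewrite in_setU1 u_mid orbT.
by move: Lku'; rewrite Lku; clear -lt_ku; lia.
Qed.

(** The form of [first_passage] that reads off the position of the label n
from the labels on [middle z]. *)
Lemma tangled_argmin L x a z : pinched -> labeling L -> tangled L ->
  L x = #|T| -> L z = #|T|.-1 ->
  maximal z -> minimal a -> (a < z)%O -> a != x ->
  exists u, [/\ (x < u)%O, u \in middle z & forall c, c \in middle z -> L u <= L c].
Proof.
move=> pin labL tanL Lx Lz max_z min_a lt_az ax.
have [k [u [_ lt_xu u_mid Lu bnd]]] :=
  first_passage pin labL tanL Lx Lz max_z min_a lt_az ax.
exists u; split=> // c c_mid; rewrite Lu.
by have [] := bnd c; first by rewrite in_setU1 c_mid orbT.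
Qed.

(** If [middle z] gets the largest labels other than n and n - 1, then at the
time of [first_passage] all smaller labels have already been promoted past 1,
so that everything outside [x] and [z |: middle z] is frozen.  Then [a] is
frozen with a label greater than that of [z], although [a] is below [z]. *)
Lemma late_middle_untangled L x a z : pinched -> labeling L ->
  L x = #|T| -> L z = #|T|.-1 ->
  maximal z -> minimal a -> (a < z)%O -> a != x ->
  (forall w c, w != x -> w \notin z |: middle z -> c \in middle z -> L w < L c) ->
  ~~ tangled L.
Proof.
move=> pin labL Lx Lz max_z min_a lt_az ax late; apply/negP=> tanL.
have [k [u [le_k _ u_mid Lu bnd]]] :=
  first_passage pin labL tanL Lx Lz max_z min_a lt_az ax.
have Lkx := tangled_top_fixed labL tanL Lx le_k.
have [|Lkz _] := bnd z; first by rewrite !inE eqxx.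
have /labelingP[injk bndk] := iter_labeling k labL.
have a_out : a \notin z |: middle z.
  by rewrite !inE negb_or min_a andbF andbT lt_eqF.
have [le_a|lt_a] := leqP ((L ^^ k) a) (#|T| - k); last first.
  have lt_az' := iter_frozen labL lt_az lt_a.
  by move: lt_az' lt_a; rewrite Lkz Lz; clear; lia.
(* The token now at [a] started at some [w].  If it has not yet passed the
   label 1, then [w] is [x] or in [z |: middle z], where no token has moved. *)
have [|w Lw] := labeling_onto (i := (L ^^ k) a + k) labL.
  by have /andP[gt0 _] := bndk a; clear -gt0 le_a le_k T1; lia.
have [wx|wx] := eqVneq w x.
  by move/eqP: ax; apply; apply: injk; rewrite Lkx -Lx -wx Lw addnK.
have [wz|wz] := boolP (w \in z |: middle z).
  have [Lkw _] := bnd w wz; move: a_out.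
  by have ->: a = w by [apply: injk; rewrite Lkw Lw addnK]; rewrite wz.
have /andP[gt0 _] := bndk a; have := late w u wx wz u_mid.
by rewrite Lw Lu; clear -gt0; lia.
Qed.

End Dynamics.

(** An element with two minimal elements below it, or two maximal elements
above it, would lie in two different open intervals of the shoelace. *)
Lemma shoelace_pinched : shoelace T -> pinched.
Proof.
case=> _ [S [_ cmpS _ disS]] c min'c max'c.
have pair a b : minimal a -> maximal b -> (a < c)%O -> (c < b)%O ->
    (a, b) \in S /\ c \in open_interval a b.
  move=> min_a max_b lt_ac lt_cb; rewrite inE lt_ac lt_cb -cmpS //.
  by rewrite /Order.comparable (ltW (lt_trans lt_ac lt_cb)).
have same a b a' b' : minimal a -> maximal b -> (a < c)%O -> (c < b)%O ->
    minimal a' -> maximal b' -> (a' < c)%O -> (c < b')%O -> (a, b) = (a', b').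
  move=> ma mb lac lcb ma' mb' lac' lcb'.
  have [pS pc] := pair a b ma mb lac lcb.
  have [qS qc] := pair a' b' ma' mb' lac' lcb'.
  apply/eqP; apply: contraTT pc => ne.
  by rewrite (disjointFl (disS _ _ pS qS ne) qc).
have [a min_a le_ac] := minimal_below c.
have [b max_b le_cb] := maximal_above c.
have lt_ac : (a < c)%O.
  by rewrite lt_neqAle le_ac andbT; apply: contraNneq min'c => <-.
have lt_cb : (c < b)%O.
  by rewrite lt_neqAle le_cb andbT; apply: contraNneq max'c => ->.
split=> [a1 a2 min1 min2 lt1 lt2 | b1 b2 max1 max2 lt1 lt2].
  by have [] := same a1 b a2 b min1 max_b lt1 lt_cb min2 max_b lt2 lt_cb.
by have [] := same a b1 a b2 min_a max1 lt_ac lt1 min_a max2 lt_ac lt2.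
Qed.

(** * Counting *)

Definition pinned x z : {set {ffun T -> 'I_#|T|.+1}} :=
  [set f : {ffun T -> 'I_#|T|.+1} |
     let L := fun w => f w : nat in
     [&& labeling L, L x == #|T| & L z == #|T|.-1]].

Lemma pinnedP x z (f : {ffun T -> 'I_#|T|.+1}) :
  reflect [/\ labeling (fun w => f w : nat), f x = #|T| :> nat &
              f z = #|T|.-1 :> nat] (f \in pinned x z).
Proof. by rewrite inE /=; apply: (iffP and3P) => -[labf /eqP fx /eqP fz]. Qed.

Lemma pinned_of_seq x z (s : seq T) : x != z -> uniq s ->
    (forall w, (w \in s) = (w != x) && (w != z)) ->
  exists2 f : {ffun T -> 'I_#|T|.+1}, f \in pinned x z &
    forall w, w \in s -> f w = (index w s).+1 :> nat.
Proof.
move=> xz us ins; set t := s ++ [:: z; x].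
have int w : w \in t.
  by rewrite mem_cat ins !inE; case: (w == x); case: (w == z).
have ut : uniq t.
  by rewrite cat_uniq us /= !ins !inE !eqxx andbF /= eq_sym xz.
have sz_t : size t = #|T| by rewrite -(card_uniqP ut); apply: eq_card.
have lt_t w : index w t < #|T| by rewrite -sz_t index_mem.
pose f := [ffun w => inord (index w t).+1 : 'I_#|T|.+1].
have fE w : f w = (index w t).+1 :> nat by rewrite ffunE inordK ?ltnS.
have sz_s : (size s).+2 = #|T| by rewrite -sz_t size_cat addn2.
exists f => [|w ws]; last by rewrite fE index_cat ws.
apply/pinnedP; rewrite !fE !index_cat !ins !eqxx andbF /= eqxx (negbTE xz).
rewrite eq_sym (negbTE xz).
split; [apply/labelingP | by rewrite addn1 | by rewrite -sz_s eqxx addn0].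
split=> [w w'|w]; last by rewrite fE ltnS lt_t.
rewrite !fE => -[eq_i].
by rewrite -(nth_index x (int w)) eq_i nth_index.
Qed.

(** Relabeling one such labeling by the permutations that fix [x] and [z]
gives them all. *)
Lemma card_pinned x z : x != z -> #|pinned x z| = (#|T| - 2)`!.
Proof.
move=> xz; set A := ~: [set x; z].
have [|||f0 /pinnedP[lab0 f0x f0z] _] := @pinned_of_seq x z (enum A) => //.
- exact: enum_uniq.
- by move=> w; rewrite mem_enum !inE negb_or.
have cardA : #|A| = #|T| - 2 by rewrite cardsCs setCK cards2 xz.
have /labelingP[inj0 bnd0] := lab0.
rewrite -cardA -card_perm.
pose F (s : {perm T}) := [ffun w => f0 (s w)].
have injF : injective F.
  move=> s t /ffunP eqF; apply/permP=> w; apply: inj0.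
  by have := eqF w; rewrite !ffunE => ->.
rewrite -(card_imset _ injF); apply: eq_card => f.
apply/idP/imsetP=> [/pinnedP[labf fx fz] | [s s_on ->]]; last first.
  have fix_s w : w \notin A -> s w = w by apply: out_perm.
  apply/pinnedP; rewrite !ffunE !fix_s ?inE ?eqxx ?orbT //.
  split=> //; apply/labelingP; split=> [w w'|w]; rewrite !ffunE.
    by move=> /inj0/perm_inj.
  exact: bnd0.
have /labelingP[injf bndf] := labf.
have ex w : exists v, f0 v == f w :> nat.
  by have [v Lv] := labeling_onto lab0 (bndf w); exists v; apply/eqP.
pose g w := xchoose (ex w).
have gE w : f0 (g w) = f w :> nat by apply/eqP; apply: (xchooseP (ex w)).
have injg : injective g by move=> v w eq_g; apply: injf; rewrite -!gE eq_g.
exists (perm injg).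
  apply/subsetP=> w; apply: contraR; rewrite !inE negbK permE.
  by case/pred2P=> ->; apply/eqP/inj0; rewrite gE ?fx ?fz ?f0x ?f0z.
by apply/ffunP=> w; rewrite ffunE permE; apply: val_inj; rewrite /= gE.
Qed.

Lemma tangled_atP z f : 1 < #|T| -> f \in tangled_at z ->
  exists x, [/\ f \in pinned x z, tangled (fun w => f w : nat), minimal x &
                (x < z)%O].
Proof.
move=> T1; rewrite inE /= => /and3P[labf tanf /eqP fz].
have [|x fx] := labeling_onto (i := #|T|) labf; first by rewrite ltnW /=.
have [min_x _] := tangled_end T1 labf tanf fx.
have [y [lt_xy le_yz _ _]] := tangled_end_below T1 labf tanf fx fz.
exists x; split=> //; last exact: lt_le_trans le_yz.
exact/pinnedP.
Qed.

Lemma card_tangled_unique x z : 1 < #|T| -> minimal x -> (x < z)%O ->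
  (forall a, minimal a -> (a < z)%O -> a = x) ->
  #|tangled_at z| = (#|T| - 2)`!.
Proof.
move=> T1 min_x lt_xz uniq_x; rewrite -(@card_pinned x z) ?lt_eqF //.
apply: eq_card => f; apply/idP/idP=> [/(tangled_atP T1)[a [fp _ min_a lt_az]]|].
  by rewrite -(uniq_x a).
case/pinnedP=> labf fx fz; rewrite inE /= labf fz eqxx andbT /=.
exact: (tangled_unique_minimal T1 labf fx fz).
Qed.

Lemma late_set_pinned x z u (U : {set T}) : x != z ->
    x \notin U -> z \notin U -> u \in U ->
  exists f : {ffun T -> 'I_#|T|.+1}, [/\ f \in pinned x z,
    forall w c, w != x -> w \notin z |: U -> c \in U -> f w < f c &
    forall c, c \in U -> f u <= f c].
Proof.
move=> xz x_mid z_mid u_mid.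
set s1 := enum (~: (x |: (z |: U))); set s := s1 ++ u :: enum (U :\ u).
have in1 w : (w \in s1) = [&& w != x, w != z & w \notin U].
  by rewrite mem_enum !inE !negb_or.
have ins w : (w \in s) = (w != x) && (w != z).
  rewrite mem_cat in1 in_cons mem_enum !inE.
  have [->|wx] := eqVneq w x.
    by rewrite (negbTE x_mid) andbF orbF; apply: contraNF x_mid => /eqP->.
  have [->|wz] := eqVneq w z.
    by rewrite (negbTE z_mid) andbF orbF; apply: contraNF z_mid => /eqP->.
  by have [->|wu] := eqVneq w u; [rewrite orbT | case: (w \in U)].
have us : uniq s.
  have uU : u \notin enum (U :\ u) by rewrite mem_enum setD11.
  rewrite cat_uniq cons_uniq uU !enum_uniq !andbT /= in1 u_mid !andbF /=.
  by apply/hasPn=> w; rewrite mem_enum !inE in1 => /andP[_ ->]; rewrite !andbF.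
have [f fp fE] := pinned_of_seq xz us ins.
have ins_mid c : c \in U -> c \in s.
  move=> cU; rewrite ins; apply/andP.
  by split; apply: contraTneq cU => ->.
have idx_mid c : c \in U -> index c s = size s1 + index c (u :: enum (U :\ u)).
  by move=> cU; rewrite index_cat in1 cU !andbF.
exists f; split=> // [w c wx|c cU]; last first.
  by rewrite !fE ?ins_mid // !idx_mid //= eqxx ltnS leq_add2l.
rewrite in_setU1 negb_or => /andP[wz wU] cU.
have ws : w \in s by rewrite ins wx.
rewrite (fE w ws) (fE c (ins_mid c cU)) ltnS (idx_mid c cU) index_cat in1 wx wz wU.
by apply: leq_trans (leq_addr _ _); rewrite index_mem in1 wx wz.
Qed.

(** Moving the label n to a fixed minimal [x] is injective on the tangled
labelings, since the labels on [middle z] survive and determine where n was.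
The labelings of [late_set_pinned] with [u] above [x] are missed: their only
possible preimage is themselves, and they are not tangled.  An [x] with such a
[u] is taken from any tangled labeling; without one there is nothing to
prove. *)
Lemma card_tangled_lt a a' z : 1 < #|T| -> pinched ->
  minimal a -> minimal a' -> a != a' -> (a < z)%O -> (a' < z)%O ->
  #|tangled_at z| < (#|T| - 2)`!.
Proof.
move=> T1 pin min_a min_a' aa' lt_az lt_a'z.
have max_z : maximal z.
  apply: contraNT aa' => max'z; apply/eqP.
  have min'z : ~~ minimal z by apply: contraL lt_az => /minimalN->.
  by have [/(_ a a')-> //] := pin z min'z max'z.
have argmin x (f : {ffun T -> 'I_#|T|.+1}) :
    f \in pinned x z -> tangled (fun w => f w : nat) ->
    exists u, [/\ (x < u)%O, u \in middle z &
                 forall c, c \in middle z -> f u <= f c].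
  case/pinnedP=> labf fx fz tanf.
  have [ax|ax] := eqVneq a x.
    apply: (@tangled_argmin T1 _ x a' z pin labf tanf) => //.
    by rewrite -ax eq_sym.
  exact: (@tangled_argmin T1 _ x a z pin labf tanf).
have middle_above x x' u : minimal x -> minimal x' -> u \in middle z ->
    (x < u)%O -> (x' < u)%O -> x = x'.
  move=> min_x min_x'; rewrite inE => /andP[lt_uz min'u] lt_xu lt_x'u.
  have max'u : ~~ maximal u by apply: contraL lt_uz => /maximalN->.
  by have [/(_ x x')-> //] := pin u min'u max'u.
have [->|[f1 f1T]] := set_0Vmem (tangled_at z); first by rewrite cards0 fact_gt0.
have [x [f1p tan1 min_x lt_xz]] := tangled_atP T1 f1T.
have [u [lt_xu u_mid _]] := argmin x f1 f1p tan1.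
clear f1 f1T f1p tan1.
have xz : x != z by rewrite lt_eqF.
pose top (f : {ffun T -> 'I_#|T|.+1}) : T := odflt x [pick v | f v == #|T| :> nat].
pose F (f : {ffun T -> 'I_#|T|.+1}) := [ffun w => f (tperm x (top f) w)].
have topE v f : f \in pinned v z -> top f = v.
  case/pinnedP=> /labelingP[injf _] fv _; rewrite /top.
  case: pickP => [w /eqP fw|/(_ v)].
    by apply: injf; rewrite fw fv.
  by rewrite fv eqxx.
have FE v f w : f \in pinned v z -> F f w = f (tperm x v w).
  by move=> fp; rewrite ffunE (topE v).
have Fmid v f c : f \in pinned v z -> minimal v -> c \in middle z -> F f c = f c.
  move=> fp min_v; rewrite (FE v) // inE => /andP[_ min'c].
  by rewrite tpermD //; apply: contraNneq min'c => <-.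
have Fpin f : f \in tangled_at z -> F f \in pinned x z.
  case/(tangled_atP T1)=> v [fp _ _ lt_vz]; have [labf fv fz] := pinnedP _ _ _ fp.
  apply/pinnedP; rewrite !(FE v) // tpermL tpermD ?lt_eqF //.
  split=> //; have /labelingP[injf bndf] := labf.
  apply/labelingP; split=> [w w'|w]; rewrite !(FE v) //.
  by move/injf/perm_inj.
have FT f : f \in tangled_at z -> exists v c,
    [/\ f \in pinned v z, tangled (fun w => f w : nat),
        minimal v, (v < c)%O & c \in middle z] /\
    forall e, e \in middle z -> F f e = f e /\ f c <= f e.
  move=> fT; have [v [fp tanf min_v lt_vz]] := tangled_atP T1 fT.
  have [c [lt_vc c_mid min_c]] := argmin v f fp tanf.
  exists v, c; split=> // e e_mid; split; [exact: (Fmid v) | exact: min_c].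
have same f c c' : f \in tangled_at z -> c \in middle z -> c' \in middle z ->
    f c <= f c' -> f c' <= f c -> c = c'.
  rewrite inE => /and3P[/labelingP[injf _] _ _] _ _ le1 le2.
  by apply/injf/eqP; rewrite eqn_leq le1.
have injF : {in tangled_at z &, injective F}.
  move=> f g fT gT eqF.
  have [v [c [[fp _ min_v lt_vc c_mid] Ff]]] := FT f fT.
  have [v' [c' [[gp _ min_v' lt_v'c' c'_mid] Fg]]] := FT g gT.
  have eq_mid e : e \in middle z -> f e = g e.
    by move=> e_mid; rewrite -(Ff e e_mid).1 -(Fg e e_mid).1 eqF.
  have cc' : c = c'.
    apply: (same f) => //; first exact: (Ff c' c'_mid).2.
    by rewrite !eq_mid //; apply: (Fg c c_mid).2.
  have vv' : v = v' by apply: (middle_above v v' c) => //; rewrite cc'.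
  apply/ffunP=> w; have /ffunP/(_ (tperm x v w)) := eqF.
  by rewrite (FE v) // (FE v g) ?vv' // tpermK.
have [||f0 [f0p late_f0 min_f0]] := late_set_pinned xz _ _ u_mid.
- by rewrite inE min_x andbF.
- by rewrite inE ltxx.
have untangled : ~~ tangled (fun w => f0 w : nat).
  have [lab0 f0x f0z] := pinnedP _ _ _ f0p.
  have [ax|ax] := eqVneq a x.
    apply: (late_middle_untangled T1 pin lab0 f0x f0z max_z min_a' lt_a'z) => //.
    by rewrite -ax eq_sym.
  exact: (late_middle_untangled T1 pin lab0 f0x f0z max_z min_a lt_az ax).
rewrite -(card_pinned xz) -(card_in_imset injF); apply/proper_card/properP.
split; first by apply/subsetP=> _ /imsetP[f fT ->]; apply: Fpin.
exists f0 => //; apply: contra untangled => /imsetP[f fT eq_f].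
have [v [c [[fp tanf min_v lt_vc c_mid] Ff]]] := FT f fT.
have [eq_u le_cu] := Ff u u_mid; have [eq_c _] := Ff c c_mid.
have uc : u = c.
  by apply: (same f) => //; rewrite -eq_u -eq_c -eq_f min_f0.
have vx : v = x by apply: (middle_above v x u) => //; rewrite uc.
suff -> : f0 = f by [].
by apply/ffunP=> w; rewrite eq_f (FE v) // vx tperm1 perm1.
Qed.

End Promotion.

Theorem theorem4p4 (d : Order.disp_t) (P : finPOrderType d) (z : P) :
  2 <= #|P| -> shoelace P ->
  #|tangled_at z| <= (#|P| - 2)`! /\
  (#|tangled_at z| = (#|P| - 2)`! <->
   exists! x : P, minimal x /\ (x < z)%O).
Proof.
move=> P1 /shoelace_pinched pin.
have [/existsP[a /andP[min_a lt_az]] | none] :=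
  boolP [exists a, minimal a && (a < z)%O]; last first.
  have no_min a : minimal a -> (a < z)%O -> False.
    by move=> min_a lt_az; case/existsP: none; exists a; rewrite min_a.
  have ->: #|tangled_at z| = 0.
    apply: eq_card0 => f; apply/negP=> /(tangled_atP P1)[x [_ _ min_x lt_xz]].
    exact: no_min min_x lt_xz.
  split=> //; split=> [eq0 | [x [[min_x lt_xz] _]]]; last by case: (no_min x).
  by have := fact_gt0 (#|P| - 2); rewrite -eq0.
have [/existsP[b /and3P[min_b lt_bz ab]] | uniq_a] :=
  boolP [exists b, [&& minimal b, (b < z)%O & a != b]].
  have lt_card := card_tangled_lt P1 pin min_a min_b ab lt_az lt_bz.
  split; first exact: ltnW.
  split=> [eq_card | [x [_ uniq_x]]]; first by rewrite eq_card ltnn in lt_card.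
  by case/eqP: ab; rewrite -(uniq_x a) // -(uniq_x b).
have {}uniq_a b : minimal b -> (b < z)%O -> b = a.
  move=> min_b lt_bz; apply/eqP; rewrite eq_sym; apply: contraNT uniq_a => ab.
  by apply/existsP; exists b; rewrite min_b lt_bz.
rewrite (card_tangled_unique P1 min_a lt_az uniq_a); split=> //; split=> // _.
by exists a; split=> // b [min_b lt_bz]; rewrite (uniq_a b).
Qed.
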